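(* Let $T\in\mathcal{B}_A(\mathcal{H})$. Then $$\omega_A^2(T)\le\inf_{\alpha,\beta}\frac{1}{\alpha+\beta}\big\|\alpha\,T^{\sharp_A}T+\beta\,TT^{\sharp_A}\big\|_A\le\frac12\big\|T^{\sharp_A}T+TT^{\sharp_A}\big\|_A,$$ where the infimum is over all reals $\alpha,\beta\ge0$ with $(\alpha,\beta)\ne(0,0)$.
   Context: $\mathcal{H}$ is a non-trivial complex Hilbert space, $\mathcal{B}(\mathcal{H})$ the bounded linear operators on it, $A\in\mathcal{B}(\mathcal{H})$ a fixed positive operator ($\langle Ax,x\rangle\ge0$ for all $x$). Put $\langle x,y\rangle_A=\langle Ax,y\rangle$ and $\|x\|_A=\langle Ax,x\rangle^{1/2}$. $\mathcal{B}_A(\mathcal{H})$ is the set of $T\in\mathcal{B}(\mathcal{H})$ for which there is $W\in\mathcal{B}(\mathcal{H})$ with $AW=T^*A$ (equivalently, $\mathcal{R}(T^*A)\subseteq\mathcal{R}(A)$); for such $T$, $T^{\sharp_A}=A^\dagger T^*A$ ($A^\dagger$ the Moore–Penrose inverse) is the unique bounded $W$ with $AW=T^*A$ and $\mathcal{R}(W)\subseteq\overline{\mathcal{R}(A)}$. Every $T\in\mathcal{B}_A(\mathcal{H})$ satisfies $\|Tx\|_A\le c\|x\|_A$ for all $x$, for some $c>0$; put $\|T\|_A=\sup_{\|x\|_A=1}\|Tx\|_A$ and $\omega_A(T)=\sup_{\|x\|_A=1}|\langle Tx,x\rangle_A|$. *)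

(* Defs.v *)
From HB Require Import structures.
From mathcomp Require Import all_boot all_order all_algebra.
From mathcomp Require Import sesquilinear complex.
From mathcomp Require Import all_classical all_reals all_analysis.

Set Implicit Arguments.
Unset Strict Implicit.
Unset Printing Implicit Defensive.

Import Order.TTheory GRing.Theory Num.Theory Num.Def.
Import numFieldNormedType.Exports.

Local Open Scope classical_set_scope.
Local Open Scope ring_scope.
Local Open Scope complex_scope.

Section Operators.
Variables (R : realType) (H : completeNormedModType R[i]).

Definition bounded_operator (T : H -> H) : Prop :=
  linear T /\ exists c : R, forall x, `|T x| <= c%:C * `|x|.

(* The inner product [dot] is linear in its first argument and conjugate-linear
   in its second one. *)
Variable dot : {dot H for (@conjC R[i])}.

(* The norm of [H] takes its values in [R[i]]. *)
Definition induces_norm : Prop := forall x : H, `|x| ^+ 2 = dot x x.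

(* The order of [R[i]] is partial: [0 <= z] says that [z] is real and
   nonnegative. *)
Definition positive_operator (A : H -> H) : Prop :=
  bounded_operator A /\ forall x, 0 <= dot (A x) x.

(* [adjoint T y] is the unique [z] with <Tx, y> = <x, z> for all [x]; it exists
   for bounded [T] by the Riesz representation theorem. *)
Definition adjoint (T : H -> H) (y : H) : H :=
  xget 0 [set z | forall x, dot (T x) y = dot x z].

Definition ortho_compl (S : set H) : set H :=
  [set x | forall y, S y -> dot x y = 0].

(* The Moore-Penrose inverse, in general an unbounded operator with domain
   range A (+) (range A)^perp: it maps [A x + z] to [x] when [x] is in
   (ker A)^perp and [z] in (range A)^perp.  Outside of this domain the value is
   the dummy [0]. *)
Definition moore_penrose (A : H -> H) (y : H) : H :=
  xget 0 [set x | ortho_compl [set u | A u = 0] x /\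
                  ortho_compl (range A) (y - A x)].

Variable A : H -> H.

Definition in_BA (T : H -> H) : Prop :=
  bounded_operator T /\
  exists2 W : H -> H, bounded_operator W & A \o W = adjoint T \o A.

(* T^{sharp_A} = A^dagger T^* A *)
Definition sharp (T : H -> H) : H -> H := moore_penrose A \o adjoint T \o A.

Definition dotA (x y : H) : R[i] := dot (A x) y.

Definition normA (x : H) : R := Num.sqrt (complex.Re (dotA x x)).

(* The real [sup] of the empty set is 0, so the next two quantities are 0 in the
   degenerate case A = 0, where no [x] satisfies [normA x = 1]. *)
Definition opnormA (T : H -> H) : R :=
  sup [set normA (T x) | x in [set x | normA x = 1]].

(* [complex.Re] only casts the modulus, a real element of [R[i]], to [R]. *)
Definition numradA (T : H -> H) : R :=
  sup [set complex.Re `|dotA (T x) x| | x in [set x | normA x = 1]].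

End Operators.

(* Main.v *)
Require Import Defs.
From HB Require Import structures.
From mathcomp Require Import all_boot all_order all_algebra.
From mathcomp Require Import sesquilinear complex.
From mathcomp Require Import all_classical all_reals all_analysis.
From mathcomp Require Import ring lra.

Set Implicit Arguments.
Unset Strict Implicit.
Unset Printing Implicit Defensive.

Import Order.TTheory GRing.Theory Num.Theory Num.Def.
Import numFieldNormedType.Exports.

Local Open Scope classical_set_scope.
Local Open Scope ring_scope.
Local Open Scope complex_scope.

(* For x with |x|_A = 1, Cauchy-Schwarz for <., .>_A bounds |<Tx, x>_A| by
   |Tx|_A and, since <Tx, x>_A = <x, T^sharp x>_A, also by |T^sharp x|_A.
   Hence (a + b) |<Tx, x>_A|^2 is at most
   a |Tx|_A^2 + b |T^sharp x|_A^2 = <(a T^sharp T + b T T^sharp) x, x>_A,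
   itself at most the A-norm of a T^sharp T + b T T^sharp.  The second
   inequality is the case a = b = 1.  As [sup] is 0 on unbounded sets, T has
   to be A-bounded; this follows from Krein's argument applied to the
   A-symmetric operator W T, where A W = T^* A. *)

(** * Real estimates and the real-valued modulus on [R[i]] *)

Section Reals.
Variable R : realType.

(** For [0 < b] the quadratic is tested at [s = 1 / b]; for [b = 0] it is affine in [s], which
    forces [k = 0]. This is the algebra behind Cauchy-Schwarz, null vectors included. *)
Lemma discriminant_le (a k b : R) : 0 <= k -> 0 <= b ->
  (forall s, 0 <= a - 2 * s * k + s ^+ 2 * k * b) -> k <= a * b.
Proof.
move=> k0 b0 h; have a0 := h 0; move: b0; rewrite le_eqVlt => /predU1P[b0|b0].
- rewrite -b0 mulr0; apply: contraT; rewrite -ltNge => kgt.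
  have := h ((a + 1) / k); rewrite -b0 mulr0 addr0 -mulrA divfK ?gt_eqF//; lra.
- have := h b^-1; rewrite expr2.
  have -> : a - 2 * b^-1 * k + b^-1 * b^-1 * k * b = (a * b - k) / b.
    by field; rewrite gt_eqF.
  by rewrite pmulr_lge0 ?invr_gt0// subr_ge0.
Qed.

Lemma le0_of_le_eps (a c : R) : (forall e, 0 < e -> a <= c * e) -> a <= 0.
Proof.
move=> h; rewrite leNgt; apply/negP => a0.
have c0 : 0 < `|c| + 1 by rewrite ltr_wpDl.
(* This [e] makes [c * e] at most [a / 2], whatever the sign of [c]. *)
have := h (a / (`|c| + 1) / 2); rewrite !divr_gt0// => /(_ isT).
have : c * (a / (`|c| + 1) / 2) <= (`|c| + 1) * (a / (`|c| + 1) / 2).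
  rewrite ler_pM2r ?divr_gt0//; apply: le_trans (ler_norm _) _; lra.
have -> : (`|c| + 1) * (a / (`|c| + 1) / 2) = a / 2 by field; rewrite gt_eqF.
lra.
Qed.

(** The norm on [R[i]] is [R[i]]-valued; this cast lands in the totally ordered [R] and is the
    expression used in [numradA]. *)
Definition modulus (z : R[i]) : R := complex.Re `|z|.

Lemma normc_modulus (z : R[i]) : `|z| = (modulus z)%:C.
Proof. by rewrite RRe_real// normr_real. Qed.

Lemma modulus_ge0 (z : R[i]) : 0 <= modulus z.
Proof. by rewrite -lecR -normc_modulus normr_ge0. Qed.

Lemma modulus_le_add (y z : R[i]) : modulus (y + z) <= modulus y + modulus z.
Proof. by rewrite -lecR rmorphD/= -!normc_modulus ler_normD. Qed.

Lemma modulusM (y z : R[i]) : modulus (y * z) = modulus y * modulus z.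
Proof. by apply: complexI; rewrite rmorphM/= -!normc_modulus normrM. Qed.

Lemma modulus_eq0 (z : R[i]) : modulus z = 0 -> z = 0.
Proof. by move=> z0; apply/eqP; rewrite -normr_eq0 normc_modulus z0. Qed.

Lemma modulusE (z : R[i]) :
  modulus z ^+ 2 = complex.Re z ^+ 2 + complex.Im z ^+ 2.
Proof. by apply: complexI; rewrite add_Re2_Im2 normc_modulus rmorphXn. Qed.

Lemma modulus_real (r : R) : 0 <= r -> modulus r%:C = r.
Proof.
by move=> r0; apply: complexI; rewrite -normc_modulus ger0_norm ?ler0c.
Qed.

Lemma Re_le_modulus (z : R[i]) : complex.Re z <= modulus z.
Proof.
by apply: le_trans (ler_norm _) _; rewrite -lecR -normc_modulus normc_ge_Re.
Qed.

End Reals.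

(** * The semi-inner product of a positive operator *)

Section SemiInner.
Variables (R : realType) (H : completeNormedModType R[i]).
Variable dot : {dot H for (@conjC R[i])}.
Variable A : H -> H.
Hypothesis hA : positive_operator dot A.

Local Notation "<< x , y >>" := (dotA dot A x y).
Local Notation nA := (normA dot A).

Let linA : linear A. Proof. by case: hA => -[]. Qed.

Lemma dotADl x y z : <<x + y, z>> = <<x, z>> + <<y, z>>.
Proof. by rewrite /dotA -[x]scale1r linA linearPl mul1r scale1r. Qed.

Lemma dotADr x y z : <<x, y + z>> = <<x, y>> + <<x, z>>.
Proof. by rewrite /dotA linearDr. Qed.

Lemma dotAZr a x y : <<x, a *: y>> = (a^*)%R * <<x, y>>.
Proof. by rewrite /dotA linearZr_LR. Qed.

Lemma dotAZl a x y : <<a *: x, y>> = a * <<x, y>>.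
Proof.
have A0 : A 0 = 0.
  by apply: (addrI (1 *: A 0)); rewrite -linA addr0 scale1r addr0 scale1r.
by rewrite /dotA -[a *: x]addr0 linA A0 addr0 linearZl_LR.
Qed.

Lemma dotANl x y : <<- x, y>> = - <<x, y>>.
Proof. by rewrite -scaleN1r dotAZl mulN1r. Qed.

Lemma dotANr x y : <<x, - y>> = - <<x, y>>.
Proof. by rewrite /dotA linearNr. Qed.

Lemma dotABl x y z : <<x - y, z>> = <<x, z>> - <<y, z>>.
Proof. by rewrite dotADl dotANl. Qed.

Lemma dotABr x y z : <<x, y - z>> = <<x, y>> - <<x, z>>.
Proof. by rewrite dotADr dotANr. Qed.

Lemma dotA_ge0 x : 0 <= <<x, x>>.
Proof. by case: hA => _; apply. Qed.

(* Polarization, as <<z, z>> is real for z = x + y and z = x + i y. *)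
Lemma dotA_herm x y : <<y, x>> = (<<x, y>>^*)%R.
Proof.
have im0 z : complex.Im <<z, z>> = 0 by exact/ger0_Im/dotA_ge0.
have := im0 (x + y); have := im0 (x + 'i *: y).
rewrite !(dotADl, dotADr) !(dotAZl, dotAZr) !raddfD /=.
have := im0 x; have := im0 y.
case: <<x, x>> => xx1 xx2; case: <<y, y>> => yy1 yy2.
case: <<x, y>> => p1 p2; case: <<y, x>> => q1 q2 /=.
move=> -> -> /= im1 im2; apply/eqP; rewrite eq_complex/=.
by apply/andP; split; apply/eqP; lra.
Qed.

Lemma normA_ge0 x : 0 <= nA x.
Proof. exact: sqrtr_ge0. Qed.

Lemma dotAxx x : <<x, x>> = (nA x ^+ 2)%:C.
Proof.
have xx0 := dotA_ge0 x.
rewrite sqr_sqrtr; first by rewrite RRe_real// ger0_real.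
by move: xx0; rewrite lecE/= => /andP[].
Qed.

Lemma normA_sqr x : nA x ^+ 2 = complex.Re <<x, x>>.
Proof. by rewrite dotAxx. Qed.

(** The factor <x, y>_A in the coefficient makes the cross terms real, leaving a quadratic in [s] of
    the shape required by [discriminant_le]. *)
Lemma normA_sqrB (x y : H) (s : R) :
  nA (x - (s%:C * <<x, y>>) *: y) ^+ 2 =
  nA x ^+ 2 - 2 * s * modulus <<x, y>> ^+ 2
  + s ^+ 2 * modulus <<x, y>> ^+ 2 * nA y ^+ 2.
Proof.
apply: complexI; rewrite -dotAxx.
rewrite !(dotABl, dotABr) !(dotAZl, dotAZr) (dotA_herm x y) !dotAxx modulusE.
case: <<x, y>> => p q.
apply/eqP; rewrite eq_complex/=; apply/andP; split; apply/eqP; ring.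
Qed.

Lemma cauchy_schwarz x y : modulus <<x, y>> <= nA x * nA y.
Proof.
rewrite -(@ler_pXn2r _ 2%N)// ?nnegrE ?modulus_ge0 ?mulr_ge0 ?normA_ge0//.
rewrite exprMn; apply: discriminant_le; rewrite ?sqr_ge0// => s.
by rewrite -normA_sqrB sqr_ge0.
Qed.

Lemma normAD x y : nA (x + y) <= nA x + nA y.
Proof.
rewrite -(@ler_pXn2r _ 2%N)// ?nnegrE ?addr_ge0 ?normA_ge0//.
rewrite normA_sqr !(dotADl, dotADr) (dotA_herm x y) !raddfD/= -!normA_sqr.
have : complex.Re (<<x, y>>^*)%R = complex.Re <<x, y>> by case: <<x, y>>.
move=> ->; have := le_trans (Re_le_modulus _) (cauchy_schwarz x y).
rewrite sqrrD mulr2n; lra.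
Qed.

Lemma normAZ a x : nA (a *: x) = modulus a * nA x.
Proof.
apply/eqP; rewrite -(@eqrXn2 _ 2%N)// ?mulr_ge0 ?modulus_ge0 ?normA_ge0//.
apply/eqP; apply: complexI; rewrite -dotAxx dotAZl dotAZr dotAxx exprMn modulusE.
case: a => p q; apply/eqP; rewrite eq_complex/=.
by apply/andP; split; apply/eqP; ring.
Qed.

End SemiInner.

(** * Orthogonal projections and adjoints *)

Section Hilbert.
Variables (R : realType) (H : completeNormedModType R[i]).
Variable dot : {dot H for (@conjC R[i])}.
Hypothesis hdot : induces_norm dot.

Local Notation N := (normA dot id).

(** With the identity in place of [A], the results on semi-inner products apply to [dot] itself. *)
Lemma positive_id : positive_operator dot id.
Proof.
split; last by move=> x; rewrite -hdot exprn_ge0.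
by split=> //; exists 1 => x; rewrite mul1r.
Qed.

Lemma norm_normA x : `|x| = (N x)%:C.
Proof.
apply/eqP; rewrite -(@eqrXn2 _ 2%N)// ?ler0c ?normA_ge0//.
by rewrite hdot -rmorphXn/= -(dotAxx positive_id).
Qed.

Lemma ballE (x y : H) (e : R) : ball x e%:C y <-> N (x - y) < e.
Proof. by rewrite -ball_normE /ball_/= norm_normA ltcR. Qed.

Lemma normA_eq0 x : N x = 0 -> x = 0.
Proof. by move=> x0; apply/eqP; rewrite -normr_eq0 norm_normA x0. Qed.

Lemma normA_sub x y : N (x - y) = N (y - x).
Proof. by apply: complexI; rewrite -!norm_normA distrC. Qed.

Lemma positive_real (e : R[i]) : 0 < e -> exists2 r : R, 0 < r & e = r%:C.
Proof.
move=> e0; have er : (complex.Re e)%:C = e by rewrite RRe_real// gtr0_real.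
by exists (complex.Re e) => //; rewrite -ltcR er.
Qed.

Lemma closed_of_approx (V : set H) :
  (forall p, (forall e, 0 < e -> exists2 v, V v & N (p - v) < e) -> V p) ->
  closed V.
Proof.
move=> h p clp; apply: h => e e0.
have [|v [Vv /ballE pv]] := clp (ball p e%:C); last by exists v.
by apply: nbhsx_ballx; rewrite ltcR.
Qed.

(** The projection is obtained as a limit of points of [V] that nearly minimise the distance to [x].
    It serves both the Riesz representation and the Moore-Penrose inverse. *)
Lemma orthogonal_projection (V : set H) : closed V -> V 0 ->
  (forall a u v, V u -> V v -> V (a *: u + v)) ->
  forall x, exists2 p, V p & forall u, V u -> dot (x - p) u = 0.
Proof.
move=> clV V0 Vlin x.
pose E := [set N (x - v) ^+ 2 | v in V].
have lbE : has_lbound E by exists 0 => _ [v _ <-]; rewrite sqr_ge0.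
have infE : has_inf E by split=> //; exists (N (x - 0) ^+ 2), 0.
pose near_min (e : R) := [set v | V v /\ N (x - v) ^+ 2 < inf E + e ^+ 2].
have near_min0 e : 0 < e -> near_min e !=set0.
  move=> e0; have [|_ [v Vv <-] hv] := @inf_adherent _ E (e ^+ 2) _ infE.
    by rewrite exprn_gt0.
  by exists v.
(* Moving [v] inside [V] along [u] cannot bring the squared distance below [inf E], so the quadratic
   in [s] with constant term [e ^+ 2] is nonnegative. *)
have near_orth e v u : 0 < e -> near_min e v -> V u ->
    modulus (dot (x - v) u) <= e * N u.
  move=> e0 [Vv hv] Vu.
  have eN0 : 0 <= e * N u by apply: mulr_ge0 (ltW e0) (normA_ge0 _ _ _).
  rewrite -(@ler_pXn2r _ 2%N)// ?nnegrE ?modulus_ge0//.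
  rewrite exprMn; apply: discriminant_le; rewrite ?sqr_ge0// => s.
  have := normA_sqrB positive_id (x - v) u s; rewrite /dotA /=.
  set z := _%:C * _; have : inf E <= N (x - v - z *: u) ^+ 2.
    apply: (ge_inf lbE); exists (z *: u + v); first exact: Vlin.
    by rewrite opprD addrA addrAC.
  move: hv; lra.
(* By [near_orth], near-minimisers are e-orthogonal to V, hence they form a
   Cauchy filter, and orthogonality passes to its limit. *)
pose F := filter_from [set e : R | 0 < e] near_min.
have FF : ProperFilter F.
  apply: filter_from_proper => //; apply: filter_from_filter.
    by exists 1; exact: ltr01.
  move=> e1 e2 /= h1 h2; exists (Num.min e1 e2); first by rewrite /= lt_min h1.
  have m0 : 0 < Num.min e1 e2 by rewrite lt_min h1.
  have le_sqr e' : Num.min e1 e2 <= e' -> Num.min e1 e2 ^+ 2 <= e' ^+ 2.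
    move=> le_e'; rewrite ler_pXn2r ?nnegrE ?(ltW m0)//.
    exact: le_trans (ltW m0) le_e'.
  by move=> v [Vv hv]; split; split=> //; apply: lt_le_trans hv _;
    rewrite lerD2l le_sqr// ge_min lexx ?orbT.
have cF : cvg F.
  apply: cauchy_cvg; apply: cauchy_exP => _ /positive_real [e e0 ->].
  have e30 : 0 < e / 3 by rewrite divr_gt0.
  have [v hv] := near_min0 _ e30; exists v; exists (e / 3) => // w hw.
  apply/ballE; set u := v - w.
  have Vu : V u by rewrite /u -[v]scale1r addrC -scaleN1r; apply: Vlin;
    [apply: (hw.1) | rewrite scale1r; apply: (hv.1)].
  (* As [u] is in [V] and equals (x - w) - (x - v), near-orthogonality can be tested on [u] itself;
     this yields [N u <= 2 * e / 3]. *)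
  have : N u ^+ 2 <= e / 3 * N u + e / 3 * N u.
    have -> : N u ^+ 2 = modulus (dot u u).
      by rewrite -[dot u u]/(dotA dot id u u) (dotAxx positive_id)
        modulus_real// sqr_ge0.
    have -> : dot u u = dot (x - w) u + (- 1) * dot (x - v) u.
      rewrite mulN1r -linearNl -linearDl; congr (dot _ u).
      by rewrite /u opprB [RHS]addrC addrA subrK.
    apply: le_trans (modulus_le_add _ _) _; apply: lerD; first exact: near_orth.
    by rewrite modulusM /modulus normrN1 mul1r; apply: near_orth.
  have := normA_ge0 dot id u; rewrite le_eqVlt => /predU1P[<-//|u0].
  rewrite expr2 -mulrDl ler_pM2r//; lra.
pose p := lim F.
have Fp : F --> p by [].
have Vp : V p.
  apply: clV => B /Fp [e e0 hB]; have [v hv] := near_min0 _ e0.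
  by exists v; split; [apply: hv.1 | apply: hB].
exists p => // u Vu; apply: modulus_eq0; apply/eqP.
rewrite eq_le modulus_ge0 andbT; apply: (@le0_of_le_eps _ _ (N u + N u)) => e e0.
have Fb : F (ball p e%:C) by apply: Fp; apply: nbhsx_ballx; rewrite ltcR.
have Fe : F (near_min e) by exists e.
have [v [/ballE pv hv]] := filter_ex (filterI Fb Fe).
have -> : dot (x - p) u = dot (x - v) u + dotA dot id (v - p) u.
  by rewrite /dotA -linearDl addrA subrK.
apply: le_trans (modulus_le_add _ _) _; rewrite mulrDl mulrC; apply: lerD.
  exact: near_orth.
apply: le_trans (cauchy_schwarz positive_id _ _) _.
by rewrite normA_sub ler_wpM2r ?normA_ge0// ltW.
Qed.

Lemma bounded_normA (T : H -> H) : bounded_operator T ->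
  exists2 c, 0 <= c & forall x, N (T x) <= c * N x.
Proof.
case=> _ [c hc]; exists `|c| => // x.
rewrite -lecR rmorphM/= -!norm_normA; apply: le_trans (hc x) _.
by rewrite ler_wpM2r// lecR ler_norm.
Qed.

Lemma linear_morphB (T : H -> H) : linear T -> {morph T : x y / x - y}.
Proof.
move=> lT x y; have := lT (-1) y x; rewrite !scaleN1r => TNyx.
by rewrite [x - y]addrC TNyx addrC.
Qed.

Lemma closed_ker (T : H -> H) : bounded_operator T -> closed [set u | T u = 0].
Proof.
move=> bT; have [c c0 hc] := bounded_normA bT.
apply: closed_of_approx => p hp; apply: normA_eq0; apply/eqP.
rewrite eq_le normA_ge0 andbT; apply: (@le0_of_le_eps _ _ c) => e e0.
have [v /= Tv pv] := hp e e0.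
rewrite -[T p]subr0 -Tv -(linear_morphB bT.1).
by apply: le_trans (hc _) _; rewrite ler_wpM2l// ltW.
Qed.

(* Riesz: a nonzero functional [x |-> <Tx, y>] is represented by a multiple of
   a vector orthogonal to its kernel. *)
Lemma adjointP (T : H -> H) : bounded_operator T ->
  forall x y, dot (T x) y = dot x (adjoint dot T y).
Proof.
(* Only the default branch of [xget] needs work: there [no] denies that a representing vector
   exists. *)
move=> bT x y; rewrite /adjoint; case: xgetP => [z _ ->//|no]; exfalso.
have [c c0 hc] := bounded_normA bT; have lT := bT.1.
pose phi u := dot (T u) y.
have phiP a u v : phi (a *: u + v) = a * phi u + phi v.
  by rewrite /phi lT linearPl.
have clV : closed [set u | phi u = 0].
  apply: closed_of_approx => p hp; apply: modulus_eq0; apply/eqP.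
  rewrite eq_le modulus_ge0 andbT.
  apply: (@le0_of_le_eps _ _ (c * N y)) => e e0.
  have [v /= v0 pv] := hp e e0.
  have -> : phi p = dotA dot id (T (p - v)) y.
    by rewrite /dotA (linear_morphB lT) linearBl /= -/(phi v) v0 subr0.
  apply: le_trans (cauchy_schwarz positive_id _ _) _; rewrite mulrAC.
  apply: ler_wpM2r; first exact: normA_ge0.
  by apply: le_trans (hc _) _; rewrite ler_wpM2l// ltW.
have phi0 : phi 0 = 0.
  by rewrite -(subrr x) /phi (linear_morphB lT) subrr linear0l.
have [x0 x0n0] : exists x0, phi x0 != 0.
  apply: contrapT => all0; apply: (no 0) => u; rewrite linear0r.
  by apply: contrapT => un0; apply: all0; exists u; apply/eqP.
have [|p Vp orth] := orthogonal_projection clV phi0 _ x0.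
  by move=> a u v /= u0 v0; rewrite phiP u0 v0 mulr0 addr0.
set w := x0 - p in orth.
have phiw : phi w = phi x0.
  by rewrite /phi (linear_morphB lT) linearBl /= -/(phi p) Vp subr0.
have w0 : dot w w != 0.
  apply: contra x0n0 => /eqP; rewrite -hdot => /eqP.
  rewrite sqrf_eq0 normr_eq0 => /eqP w0.
  by rewrite -phiw w0 phi0.
apply: (no (((phi w / dot w w)^*)%R *: w)) => u.
rewrite linearZr_LR /= conjCK.
(* This combination is killed by [phi], hence orthogonal to [w]; solving for [phi u] gives the
   representation. *)
have : dot (- (phi u / phi w) *: w + u) w = 0.
  rewrite [LHS](dotA_herm positive_id w) [dotA _ _ _ _]orth ?rmorph0//=.
  by rewrite phiP mulNr divfK ?addNr// phiw.
rewrite linearPl => /eqP; rewrite mulNr addrC subr_eq0 => /eqP ->.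
have phiw0 : phi w != 0 by rewrite phiw.
by rewrite -/(phi u); field; apply/andP.
Qed.

End Hilbert.

(** * Sequences with a doubling inequality *)

Section Growth.
Variable R : realType.

Lemma bernoulli_inequality (d : R) n : 0 <= d -> 1 + n%:R * d <= (1 + d) ^+ n.
Proof.
move=> d0; elim: n => [|n IH]; first by rewrite mul0r addr0 expr0.
have nd0 : 0 <= n%:R * d * d by rewrite !mulr_ge0.
have : (1 + d) * (1 + n%:R * d) <= (1 + d) * (1 + d) ^+ n.
  by rewrite ler_wpM2l// addr_ge0.
rewrite exprS -natr1; lra.
Qed.

(** Iterated doubling and the growth bound give (a_1 / (c t))^(2^n) <= K / t for all n. A ratio
    above 1 would make the left side unbounded, by Bernoulli. *)
Lemma le_of_doubling (a : nat -> R) (K c t : R) : 0 < c -> 0 < t ->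
  (forall n, 0 <= a n) -> (forall n, a n ^+ 2 <= a n.*2 * t) ->
  (forall n, a n <= K * c ^+ n) -> a 1%N <= c * t.
Proof.
move=> c0 t0 a0 adbl aK.
have ct0 : 0 < c * t by rewrite mulr_gt0.
have iter n : a 1%N ^+ (2 ^ n) * t <= a (2 ^ n)%N * t ^+ (2 ^ n).
  elim: n => [|n IH]; first by rewrite expn0 !expr1.
  rewrite -(ler_pM2r t0); rewrite expnS mul2n -addnn !exprD.
  have -> : a 1%N ^+ (2 ^ n) * a 1%N ^+ (2 ^ n) * t * t =
    (a 1%N ^+ (2 ^ n) * t) ^+ 2 by ring.
  have tn0 : 0 <= t ^+ (2 ^ n) by rewrite exprn_ge0// ltW.
  have lhs0 : 0 <= a 1%N ^+ (2 ^ n) * t by rewrite mulr_ge0 ?exprn_ge0// ltW.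
  apply: (@le_trans _ _ ((a (2 ^ n)%N * t ^+ (2 ^ n)) ^+ 2)).
    by rewrite ler_pXn2r ?nnegrE// mulr_ge0.
  rewrite addnn exprMn.
  have := ler_wpM2r (sqr_ge0 (t ^+ (2 ^ n))) (adbl (2 ^ n)%N).
  by move/le_trans; apply; rewrite mulrAC expr2.
rewrite leNgt; apply/negP => gt1.
pose d := a 1%N / (c * t) - 1.
have d0 : 0 < d by rewrite subr_gt0 ltr_pdivlMr// mul1r.
have bound n : (1 + d) ^+ (2 ^ n) <= K / t.
  rewrite ler_pdivlMr// addrC subrK expr_div_n mulrAC.
  rewrite ler_pdivrMr ?exprn_gt0//; apply: le_trans (iter n) _.
  by rewrite exprMn mulrA ler_wpM2r// exprn_ge0// ltW.
have [n hn] : exists n : nat, K / t / d < n%:R.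
  exists (truncn (K / t / d)).+1; exact: truncnS_gt.
have := le_trans (bernoulli_inequality (2 ^ n) (ltW d0)) (bound n).
have : n%:R * d <= (2 ^ n)%N%:R * d.
  by rewrite ler_pM2r// ler_nat ltnW// ltn_expl.
move: hn; rewrite ltr_pdivrMr//; lra.
Qed.

End Growth.

(** * A-boundedness and the A-adjoint *)

Section Sharp.
Variables (R : realType) (H : completeNormedModType R[i]).
Variable dot : {dot H for (@conjC R[i])}.
Hypothesis hdot : induces_norm dot.
Variable A : H -> H.
Hypothesis hA : positive_operator dot A.

Local Notation N := (normA dot id).
Local Notation "<< x , y >>" := (dotA dot A x y).
Local Notation nA := (normA dot A).

(** A positive operator is self-adjoint, because both forms are Hermitian. *)
Lemma dotA_sym x y : <<x, y>> = dot x (A y).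
Proof.
by rewrite (dotA_herm hA y x) [RHS](dotA_herm (positive_id hdot) (A y) x).
Qed.

Lemma normA_le_norm : exists2 K, 0 <= K & forall x, nA x <= K * N x.
Proof.
have [c c0 hc] := bounded_normA hdot hA.1.
exists (Num.sqrt c) => [|x]; first exact: sqrtr_ge0.
rewrite -(@ler_pXn2r _ 2%N)// ?nnegrE ?mulr_ge0 ?sqrtr_ge0 ?normA_ge0//.
rewrite exprMn (sqr_sqrtr c0) (normA_sqr hA); apply: le_trans (Re_le_modulus _) _.
apply: le_trans (cauchy_schwarz (positive_id hdot) (A x) x) _.
by rewrite expr2 mulrA ler_wpM2r// normA_ge0.
Qed.

(* Krein: Cauchy-Schwarz gives |S^n x|_A^2 <= |S^(2n) x|_A |x|_A, to be
   iterated along n = 2^k, while |S^n x|_A grows at most like |S|^n. *)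
Lemma symmetric_bounded (S : H -> H) : bounded_operator S ->
  (forall x y, <<S x, y>> = <<x, S y>>) ->
  exists2 c, 0 <= c & forall x, nA (S x) <= c * nA x.
Proof.
move=> bS symS; have [c c0 hc] := bounded_normA hdot bS.
have [K K0 hK] := normA_le_norm.
(* [le_of_doubling] needs a positive growth rate, and [c] may be 0. *)
have c1 : 0 < c + 1 by rewrite ltr_wpDl.
have iterS n x : N (iter n S x) <= (c + 1) ^+ n * N x.
  elim: n => [|n IH]; first by rewrite mul1r.
  apply: le_trans (hc _) _; rewrite exprS -mulrA.
  by rewrite ler_pM ?normA_ge0// lerDl.
have sym_iter n x y : <<iter n S x, y>> = <<x, iter n S y>>.
  by elim: n y => //= n IH y; rewrite symS IH -iterSr.
have dbl n x : nA (iter n S x) ^+ 2 <= nA (iter n.*2 S x) * nA x.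
  rewrite (normA_sqr hA) -sym_iter -iterD addnn.
  exact: le_trans (Re_le_modulus _) (cauchy_schwarz hA _ _).
exists (c + 1) => [|x]; first exact: ltW.
(* If |x|_A = 0, the doubling inequality for n = 1 already gives |S x|_A = 0; otherwise [t] is
   |x|_A. *)
have := normA_ge0 dot A x; rewrite le_eqVlt => /predU1P[x0|x0].
  have := dbl 1%N x; rewrite -x0 !mulr0 => S0.
  have := sqr_ge0 (nA (S x)) => S0'.
  have : nA (S x) ^+ 2 == 0 by rewrite eq_le S0.
  by rewrite sqrf_eq0 => /eqP ->.
apply: (@le_of_doubling _ (fun n => nA (iter n S x)) (K * N x)) => // n.
  exact: normA_ge0.
by apply: le_trans (hK _) _; rewrite -mulrA ler_wpM2l// mulrC iterS.
Qed.

Variable T : H -> H.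
Hypothesis hT : in_BA dot A T.

(** Since [W] is an A-adjoint of [T], |T x|_A^2 = <x, W T x>_A <= |x|_A |W T x|_A, and Krein's bound
    for [W \o T] applies. The operator [W] is taken because its boundedness on [H] comes with
    [in_BA]. *)
Lemma adjointA_bounded : exists2 c, 0 <= c & forall x, nA (T x) <= c * nA x.
Proof.
case: hT => bT [W bW AW].
have dotW x y : <<T x, y>> = <<x, W y>>.
  rewrite !dotA_sym (adjointP hdot bT); congr (dot x _).
  by have /(congr1 (@^~ y)) := AW.
have [c c0 hc] : exists2 c, 0 <= c & forall x, nA ((W \o T) x) <= c * nA x.
  apply: symmetric_bounded => [|x y /=]; last first.
    by rewrite (dotA_herm hA y (W (T x))) -!dotW -(dotA_herm hA).
  split=> [a u v /=|]; first by rewrite bT.1 bW.1.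
  case: bW.2 => w hw; case: bT.2 => t ht; exists (`|w| * `|t|) => x /=.
  have wt : w%:C * `|T x| <= `|w|%:C * `|T x|.
    by rewrite ler_wpM2r// lecR ler_norm.
  apply: le_trans (hw _) (le_trans wt _); rewrite rmorphM/= -mulrA.
  rewrite ler_wpM2l ?ler0c//; apply: le_trans (ht _) _.
  by rewrite ler_wpM2r// lecR ler_norm.
exists (Num.sqrt c) => [|x]; first exact: sqrtr_ge0.
rewrite -(@ler_pXn2r _ 2%N)// ?nnegrE ?mulr_ge0 ?sqrtr_ge0 ?normA_ge0//.
rewrite exprMn (sqr_sqrtr c0) (normA_sqr hA) dotW.
apply: le_trans (Re_le_modulus _) _; apply: le_trans (cauchy_schwarz hA _ _) _.
by rewrite expr2 mulrCA ler_wpM2l ?normA_ge0// hc.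
Qed.

(* If A W = T^* A, projecting [W x] away from the kernel of [A] solves
   A u = T^* A x. *)
Lemma A_sharp x : A (sharp dot A T x) = adjoint dot T (A x).
Proof.
case: hT => _ [W _ /(congr1 (@^~ x))/= AW].
have lA := linear_morphB hA.1.1.
rewrite -AW /sharp /= -AW /moore_penrose; case: xgetP => [u _ [_ orth]|no].
(* The vector [A (W x - u)] lies in the range of [A] and is orthogonal to that range, so it
   vanishes. *)
- have /eqP := orth (A (W x - u)) (imageT A _).
  rewrite -lA -hdot sqrf_eq0 normr_eq0 lA subr_eq0 => /eqP -> //.
- have A0 : A 0 = 0 by rewrite -{1}(subrr x) lA subrr.
  have [a u v /= u0 v0|p p0 orth] :=
    orthogonal_projection hdot (closed_ker hdot hA.1) A0 _ (W x).
    by rewrite hA.1.1 u0 v0 scaler0 addr0.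
  exfalso; apply: (no (W x - p)); split=> // y _.
  by rewrite lA p0 subr0 subrr linear0l.
Qed.

Lemma sharpP x y : <<T x, y>> = <<x, sharp dot A T y>>.
Proof. by rewrite !dotA_sym A_sharp (adjointP hdot hT.1). Qed.

Lemma sharpP' x y : <<sharp dot A T x, y>> = <<x, T y>>.
Proof. by rewrite (dotA_herm hA y) -sharpP -(dotA_herm hA). Qed.

(** With s the image of x, |s|_A^2 = <T s, x>_A <= c |s|_A |x|_A; then |s|_A is cancelled. *)
Lemma sharp_bounded c : (forall x, nA (T x) <= c * nA x) ->
  forall x, nA (sharp dot A T x) <= c * nA x.
Proof.
move=> hc x; set s := sharp dot A T x.
have := normA_ge0 dot A s; rewrite le_eqVlt => /predU1P[<-|s0].
  (* The sign of [c] is not given; [0 <= c * nA x] follows from the bound on [T x]. *)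
  exact: le_trans (normA_ge0 _ _ _) (hc x).
rewrite -(ler_pM2l s0) -expr2 (normA_sqr hA) -sharpP.
apply: le_trans (Re_le_modulus _) _; apply: le_trans (cauchy_schwarz hA _ _) _.
by rewrite mulrA (mulrC _ c) ler_wpM2r ?normA_ge0.
Qed.

End Sharp.

(** * Suprema defining the A-norm and the A-numerical radius *)

Section Radius.
Variables (R : realType) (H : completeNormedModType R[i]).
Variable dot : {dot H for (@conjC R[i])}.
Variable A : H -> H.

Lemma sup_ge0 (E : set R) : (forall x, E x -> 0 <= x) -> 0 <= sup E.
Proof.
move=> E0; have [supE|/sup_out->//] := pselect (has_sup E).
have [x Ex] := supE.1.
by apply: le_trans (E0 x Ex) _; apply: ub_le_sup => //; exact: supE.2.
Qed.

Lemma opnormA_ge0 (S : H -> H) : 0 <= opnormA dot A S.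
Proof. by apply: sup_ge0 => _ [x _ <-]; apply: normA_ge0. Qed.

(** The assumed A-bound keeps the set bounded, so that [sup] really is an upper bound. *)
Lemma le_opnormA (S : H -> H) c :
  (forall x, normA dot A (S x) <= c * normA dot A x) ->
  forall x, normA dot A x = 1 -> normA dot A (S x) <= opnormA dot A S.
Proof.
move=> hc x x1; apply: ub_le_sup; last by exists x.
by exists c => _ [y /= y1 <-]; apply: le_trans (hc y) _; rewrite y1 mulr1.
Qed.

(** The condition [0 <= b] covers the case where no vector has A-norm 1 and [sup] is 0. *)
Lemma numradA_le (T : H -> H) b : 0 <= b ->
  (forall x, normA dot A x = 1 -> modulus (dotA dot A (T x) x) <= b) ->
  numradA dot A T <= b.
Proof.
move=> b0 hb; rewrite /numradA; set E := [set _ | _ in _].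
have [->|/set0P E0] := eqVneq E set0; first by rewrite sup0.
by apply: ge_sup => // _ [x x1 <-]; apply: hb.
Qed.

Lemma numradA_ge0 (T : H -> H) : 0 <= numradA dot A T.
Proof. by apply: sup_ge0 => _ [x _ <-]; apply: modulus_ge0. Qed.

End Radius.

(** * The inequality for fixed weights, and the infimum *)

Section Weighted.
Variables (R : realType) (H : completeNormedModType R[i]).
Variable dot : {dot H for (@conjC R[i])}.
Hypothesis hdot : induces_norm dot.
Variables A T : H -> H.
Hypotheses (hA : positive_operator dot A) (hT : in_BA dot A T).

Local Notation Ts := (sharp dot A T).
Local Notation nA := (normA dot A).

Lemma numradA_sqr_le (a b : R) : 0 <= a -> 0 <= b -> 0 < a + b ->
  numradA dot A T ^+ 2 <=
  (a + b)^-1 * opnormA dot A (fun x => a%:C *: Ts (T x) + b%:C *: T (Ts x)).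
Proof.
move=> a0 b0 ab0; set S := fun x => _; set M := opnormA dot A S.
have [c c0 hc] := adjointA_bounded hdot hA hT.
have hcs := sharp_bounded hdot hA hT hc.
(* A crude bound, wanted only so that [le_opnormA] applies to [S]. *)
have boundS x : nA (S x) <= ((a + b) * (c * c)) * nA x.
  apply: le_trans (normAD hA _ _) _; rewrite !(normAZ hA) !modulus_real//.
  rewrite -mulrA mulrDl; apply: lerD; apply: ler_wpM2l => //; rewrite -mulrA.
    by apply: le_trans (hcs _) _; rewrite ler_wpM2l.
  by apply: le_trans (hc _) _; rewrite ler_wpM2l.
have M0 : 0 <= M := opnormA_ge0 _ _ _.
have key x : nA x = 1 -> (a + b) * modulus (dotA dot A (T x) x) ^+ 2 <= M.
  move=> x1; set m := modulus _.
  have m1 : m ^+ 2 <= nA (T x) ^+ 2.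
    rewrite ler_pXn2r ?nnegrE ?modulus_ge0 ?normA_ge0//.
    by have := cauchy_schwarz hA (T x) x; rewrite x1 mulr1.
  have m2 : m ^+ 2 <= nA (Ts x) ^+ 2.
    rewrite ler_pXn2r ?nnegrE ?modulus_ge0 ?normA_ge0// /m (sharpP hdot hA hT).
    by have := cauchy_schwarz hA x (Ts x); rewrite x1 mul1r.
  apply: le_trans (le_opnormA boundS x1).
  apply: (@le_trans _ _ (modulus (dotA dot A (S x) x))); last first.
    by have := cauchy_schwarz hA (S x) x; rewrite x1 mulr1.
  have -> : dotA dot A (S x) x = (a * nA (T x) ^+ 2 + b * nA (Ts x) ^+ 2)%:C.
    rewrite (dotADl hA) !(dotAZl hA) (sharpP' hdot hA hT)
      (sharpP hdot hA hT (Ts x)).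
    by rewrite !(dotAxx hA) -!rmorphM/= -rmorphD.
  rewrite modulus_real; first by rewrite mulrDl lerD// ler_wpM2l.
  by apply: addr_ge0; apply: mulr_ge0 => //; apply: sqr_ge0.
(* [numradA] is a supremum of moduli, not of squares, so the right side is written as the square of
   its root before passing to the supremum. *)
rewrite -[leRHS]sqr_sqrtr ?mulr_ge0 ?invr_ge0 ?(ltW ab0)//.
rewrite ler_pXn2r ?nnegrE ?numradA_ge0 ?sqrtr_ge0//.
apply: numradA_le; first exact: sqrtr_ge0.
move=> x x1; rewrite -(ger0_norm (modulus_ge0 _)) -sqrtr_sqr ler_wsqrtr//.
by rewrite mulrC ler_pdivlMr// mulrC key.
Qed.

End Weighted.

Theorem corollary3p17 (R : realType) (H : completeNormedModType R[i])
    (dot : {dot H for (@conjC R[i])}) (hdot : induces_norm dot)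
    (hH : exists x : H, x != 0)
    (A : H -> H) (hA : positive_operator dot A)
    (T : H -> H) (hT : in_BA dot A T) :
  let Ts := sharp dot A T in
  let bound := inf
    [set (ab.1 + ab.2)^-1 *
         opnormA dot A (fun x => ab.1%:C *: Ts (T x) + ab.2%:C *: T (Ts x))
    | ab in [set ab : R * R | [/\ 0 <= ab.1, 0 <= ab.2 & ab != (0, 0)]]] in
  numradA dot A T ^+ 2 <= bound /\
  bound <= 2^-1 * opnormA dot A (fun x => Ts (T x) + T (Ts x)).
Proof.
move=> Ts bound; rewrite {}/bound; set E := [set _ | _ in _].
(* The value at (1, 1) serves twice: it makes [E] nonempty for the first inequality and gives the
   second one. *)
have E11 : E (2^-1 * opnormA dot A (fun x => Ts (T x) + T (Ts x))).
  exists (1, 1); last first.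
    by congr (_ * opnormA dot A _); apply/funext => x /=; rewrite !scale1r.
  by split; rewrite /= ?ler01// xpair_eqE oner_eq0.
have lbE : lbound E (numradA dot A T ^+ 2).
  move=> _ [[a b] /= [a0 b0 ab0] <-]; apply: numradA_sqr_le => //.
  rewrite lt_neqAle addr_ge0// andbT eq_sym paddr_eq0//.
by split; [apply: lb_le_inf => //; eexists; exact: E11
          | apply: ge_inf => //; eexists; exact: lbE].
Qed.
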